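(* Let $\mathbf{A}\in\mathbb{R}^{n\times n}$ be symmetric positive semidefinite, let $f\in\mathscr{F}$, let $1\le k\le n$, and let $\boldsymbol{\omega}_1,\dots,\boldsymbol{\omega}_k\sim\mathcal{N}(\mathbf{0},\mathbf{I})$ be independent random vectors in $\mathbb{R}^n$. Then the i-FlexTrace estimator $$\widehat{\mathrm{tr}}_{\mathrm{iFT}}=\frac1k\sum_{i=1}^k\left(\operatorname{tr} f(\widehat{\mathbf{A}}_{-i})+\boldsymbol{\omega}_i^\top\big(f(\mathbf{A})-f(\widehat{\mathbf{A}}_{-i})\big)\boldsymbol{\omega}_i\right)$$ is an unbiased estimator of $\operatorname{tr}(f(\mathbf{A}))$, i.e. $\mathbb{E}[\widehat{\mathrm{tr}}_{\mathrm{iFT}}]=\operatorname{tr}(f(\mathbf{A}))$.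
   Context: $\mathscr{F}$ is the set of functions $f:[0,\infty)\to[0,\infty)$ with $f(0)=0$ that are operator monotone, i.e. $\mathbf{C}\preceq\mathbf{D}$ implies $f(\mathbf{C})\preceq f(\mathbf{D})$ for symmetric positive semidefinite matrices, where $\preceq$ is the Loewner order. For symmetric positive semidefinite $\mathbf{M}=\mathbf{U}\operatorname{diag}(\mu_i)\mathbf{U}^\top$, $f(\mathbf{M})=\mathbf{U}\operatorname{diag}(f(\mu_i))\mathbf{U}^\top$. $\boldsymbol{\Omega}\in\mathbb{R}^{n\times k}$ is the matrix with columns $\boldsymbol{\omega}_1,\dots,\boldsymbol{\omega}_k$. The Nyström approximation of $\mathbf{A}$ with test matrix $\mathbf{T}$ is $\mathbf{A}\mathbf{T}(\mathbf{T}^\top\mathbf{A}\mathbf{T})^\dagger(\mathbf{A}\mathbf{T})^\top$, with $\dagger$ the Moore–Penrose pseudoinverse. $\widehat{\mathbf{A}}_{-i}$ is the Nyström approximation of $\mathbf{A}$ whose test matrix is $\boldsymbol{\Omega}$ with its $i$-th column removed (an empty test matrix gives the zero matrix). *)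

(* Defs.v *)
From HB Require Import structures.
From mathcomp Require Export all_boot all_order all_algebra.
From mathcomp Require Export all_classical all_reals all_analysis.

Set Implicit Arguments.
Unset Strict Implicit.
Unset Printing Implicit Defensive.

Import Order.TTheory GRing.Theory Num.Theory.
Import numFieldNormedType.Exports.

Local Open Scope classical_set_scope.
Local Open Scope ring_scope.

Section Matrices.
Context {R : realType}.

Definition psdmx {n : nat} (M : 'M[R]_n) : Prop :=
  M^T = M /\ forall x : 'cV[R]_n, 0 <= (x^T *m M *m x) 0 0.

Definition loewner_le {n : nat} (C D : 'M[R]_n) : Prop := psdmx (D - C).

Definition is_matfun (f : R -> R) {n : nat} (M N : 'M[R]_n) : Prop :=
  exists (U : 'M[R]_n) (mu : 'rV[R]_n),
    [/\ U *m U^T = 1%:M,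
        M = U *m diag_mx mu *m U^T &
        N = U *m diag_mx (map_mx f mu) *m U^T].

(* f(M): by the spectral theorem such an N exists when M is symmetric, and it
   does not depend on the diagonalization chosen; 0 is only a default value
   for non-symmetric M. *)
Definition matfun (f : R -> R) {n : nat} (M : 'M[R]_n) : 'M[R]_n :=
  xget 0 [set N | is_matfun f M N].

Definition operator_monotone (f : R -> R) : Prop :=
  forall (m : nat) (C D : 'M[R]_m), psdmx C -> psdmx D ->
    loewner_le C D -> loewner_le (matfun f C) (matfun f D).

(* A function [0, oo) -> [0, oo) is represented by a function on R of which
   only the values on [0, oo) matter: matfun is applied to positive
   semidefinite matrices only, whose eigenvalues are nonnegative. *)
Definition operator_monotone_class (f : R -> R) : Prop :=
  [/\ forall x, 0 <= x -> 0 <= f x, f 0 = 0 & operator_monotone f].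

Definition is_mp_inverse {m n : nat} (M : 'M[R]_(m, n)) (X : 'M[R]_(n, m)) :
    Prop :=
  [/\ M *m X *m M = M, X *m M *m X = X,
      (M *m X)^T = M *m X & (X *m M)^T = X *m M].

(* The Penrose equations have exactly one solution, so the default value 0 is
   never used. *)
Definition mp_inverse {m n : nat} (M : 'M[R]_(m, n)) : 'M[R]_(n, m) :=
  xget 0 [set X | is_mp_inverse M X].

(* For l = 0 this is the zero matrix, as a product through dimension 0. *)
Definition nystrom {n l : nat} (A : 'M[R]_n) (S : 'M[R]_(n, l)) : 'M[R]_n :=
  A *m S *m mp_inverse (S^T *m A *m S) *m (A *m S)^T.

(* col' i Om is Om with its i-th column removed. *)
Definition iflextrace (f : R -> R) {n k : nat} (A : 'M[R]_n)
    (Om : 'M[R]_(n, k)) : R :=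
  k%:R^-1 * \sum_(i < k)
    (let fAi := matfun f (nystrom A (col' i Om)) in
     \tr fAi + ((col i Om)^T *m (matfun f A - fAi) *m col i Om) 0 0).

End Matrices.

Section RandomVectors.
Context {d : measure_display} {T : measurableType d} {R : realType}.
Variable P : probability T R.

(* Random vectors of R^n are random variables in n.-tuple R, which the library
   equips with the product (= Borel) sigma-algebra. N(0, I_n) is the n-fold
   product of N(0, 1), which is determined by its values on measurable boxes. *)
Definition standard_normal_vector {n : nat} (X : {RV P >-> n.-tuple R}) : Prop :=
  forall B : 'I_n -> set R, (forall a, measurable (B a)) ->
    distribution P X [set x | forall a, B a (tnth x a)] =
    (\prod_(a < n) normal_prob 0 1 (B a))%E.

(* Taking some of the B i to be setT gives the product rule for subfamilies. *)
Definition mutually_independent {d' : measure_display}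
    {T' : measurableType d'} {k : nat} (X : 'I_k -> {RV P >-> T'}) : Prop :=
  forall B : 'I_k -> set T', (forall i, measurable (B i)) ->
    P [set w | forall i, B i (X i w)] =
    (\prod_(i < k) P (X i @^-1` B i))%E.

Definition test_matrix {n k : nat} (omega : 'I_k -> {RV P >-> n.-tuple R})
    (w : T) : 'M[R]_(n, k) :=
  \matrix_(a, i) tnth (omega i w) a.

End RandomVectors.

(* Main.v *)
(** Let [C = f(A)] and [C_i = f(Ahat_{-i})].  The matrix [C_i] is a function of
    the vectors other than [omega_i], hence independent of [omega_i], and
    [E (omega_i omega_i^T) = I]; therefore
    [E (omega_i^T (C - C_i) omega_i) = tr C - E (tr C_i)], so that each of the [k]
    summands has mean [tr C].  Integrability holds because [C_i] is bounded:
    [0 <= Ahat_{-i} <= A] in the Loewner order, so [0 = f(0) <= C_i <= C] by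
    operator monotonicity.  Measurability of [C_i] does not follow from
    continuity, since [f] may jump at [0].  But the functions [g] for which
    [M |-> g(M)] is measurable on symmetric matrices are stable under sums,
    products, inverses and pointwise limits, hence contain every nonnegative Borel
    function; this covers both the monotone [f] and the pseudoinverse of [M],
    which is [g(M)] for [g x = x^-1] (recall [0^-1 = 0]). *)

From HB Require Import structures.
From mathcomp Require Import complex spectral sesquilinear measurable_realfun.
From mathcomp Require Import ring lra.
Require Import Defs.

Set Implicit Arguments.
Unset Strict Implicit.
Unset Printing Implicit Defensive.

Import Order.TTheory GRing.Theory Num.Theory.
Import numFieldNormedType.Exports.

Local Open Scope classical_set_scope.
Local Open Scope ring_scope.

(** * The real spectral theorem *)

Section RealSpectralTheorem.
Context {R : realType}.

(** Over the complex numbers [A] becomes Hermitian, so it is unitarily diagonalizable with real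
    diagonal; a diagonal entry is an eigenvalue of the complexified matrix, and being an eigenvalue
    does not depend on the field extension. *)
Lemma symmetric_eigenvalue n (A : 'M[R]_n.+1) :
  A^T = A -> exists a : R, eigenvalue A a.
Proof.
move=> symA; pose toC : {rmorphism R -> R[i]} := real_complex R.
have hA : map_mx toC A \is hermsymmx.
  apply: realsym_hermsym.
    apply/is_hermitianmxP; rewrite expr0 scale1r.
    by apply/matrixP => i j; rewrite !mxE -[in LHS]symA mxE.
  apply/mxOverP => i j; rewrite mxE; apply/complex_realP; by exists (A i j).
have Dreal := hermitian_spectral_diag_real hA.
have /orthomx_spectralP := hermitian_normalmx hA.
set Q := spectralmx _; set D := spectral_diag _ => AE.
have Qu : Q \in unitmx := spectral_unit _.
have /complex_realP[a Da] : D 0 0 \is Num.real := mxOverP Dreal 0 0.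
exists a; rewrite -(eigenvalue_map toC).
(* Since [A] is [Q^-1 D Q], the rows of [Q] are left eigenvectors; they are nonzero because [Q] is
   invertible. *)
apply/eigenvalueP; exists (row 0 Q).
  rewrite AE -row_mul !mulmxA mulmxV// mul1mx row_mul.
  by rewrite row_diag_mx Da -scalemxAl -rowE.
apply/eqP => r0; move: Qu; rewrite -row_free_unit => /row_freeP[B QB].
move/(congr1 (mulmx^~ B)): r0.
rewrite -row_mul QB mul0mx => /matrixP/(_ 0 0).
by rewrite !mxE eqxx => /eqP; rewrite oner_eq0.
Qed.

(** [H] is the reflection in the hyperplane orthogonal to [u = v - e], which exchanges the unit
    vectors [v] and [e]; the scalar [c = 1 - v 0 0] is half the squared norm of [u]. *)
Lemma householder n (v : 'cV[R]_n.+1) : v^T *m v = 1%:M ->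
  exists H : 'M[R]_n.+1, [/\ H *m H = 1%:M, H^T = H & H *m v = delta_mx 0 0].
Proof.
move=> v1; pose e : 'cV[R]_n.+1 := delta_mx 0 0.
have [ve|ve] := eqVneq v e.
  by exists 1%:M; split; rewrite ?mulmx1 ?trmx1 ?mul1mx.
have vTe : v^T *m e = (v 0 0)%:M.
  by rewrite -colE; apply/matrixP => i j; rewrite !ord1 !mxE eqxx.
have eTv : e^T *m v = (v 0 0)%:M.
  by rewrite -[RHS]tr_scalar_mx -vTe trmx_mul trmxK.
have eTe : e^T *m e = 1%:M.
  by rewrite -colE; apply/matrixP => i j; rewrite !ord1 !mxE !eqxx.
pose u := v - e; pose c := 1 - v 0 0.
have uTv : u^T *m v = c%:M.
  by rewrite /u linearB /= mulmxBl v1 eTv -scalar_mx_is_additive.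
have uTu : u^T *m u = (c *+ 2)%:M.
  rewrite {2}/u mulmxBr uTv /u linearB /= mulmxBl vTe eTe.
  by rewrite -!scalar_mx_is_additive /c; congr (_%:M); ring.
(* If [c] vanished, so would the sum of squares [u^T u], forcing [v = e]. *)
have c0 : c != 0.
  apply: contra ve => /eqP c0; move: uTu; rewrite c0 mul0rn => /matrixP/(_ 0 0).
  rewrite !mxE eqxx /= => /eqP; rewrite psumr_eq0 => [/allP h|i _]; last first.
    by rewrite mxE -expr2 sqr_ge0.
  rewrite -subr_eq0; apply/eqP/matrixP => i j; rewrite !ord1.
  have := h i; rewrite mem_index_enum => /(_ isT).
  by rewrite mxE mulf_eq0 orbb => /eqP; rewrite /u => ->; rewrite mxE.
have vu : v - u = e by rewrite /u opprB addrC subrK.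
exists (1%:M - c^-1 *: (u *m u^T)); clearbody u; split.
- rewrite mulmxBr mulmx1 mulmxBl mul1mx -scalemxAl -scalemxAr scalerA.
  rewrite mulmxA -(mulmxA u) uTu mul_mx_scalar -scalemxAl !scalerA.
  rewrite -scalerBl -addrA -opprD -scalerDl.
  rewrite [X in X *: _](_ : _ = 0) ?scale0r ?subr0//.
  by field.
- by rewrite linearB /= trmx1 linearZ /= trmx_mul trmxK.
- rewrite mulmxBl mul1mx -scalemxAl -mulmxA uTv mul_mx_scalar scalerA.
  by rewrite mulVf// scale1r vu.
Qed.

(** Deflation: a reflection [H] carries a unit eigenvector to the first basis vector, so [H A H] is
    block diagonal with the eigenvalue and a smaller symmetric block, to which the induction
    hypothesis applies. *)
Lemma symmetric_spectral n (A : 'M[R]_n) : A^T = A ->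
  exists (U : 'M[R]_n) (mu : 'rV[R]_n),
    U *m U^T = 1%:M /\ A = U *m diag_mx mu *m U^T.
Proof.
elim: n A => [|n IH] A symA.
  by exists 1%:M, 0; split; apply/matrixP => -[].
have [a /eigenvalueP[w wA w0]] := symmetric_eigenvalue symA.
have Aw : A *m w^T = a *: w^T by rewrite -{1}symA -trmx_mul wA linearZ.
pose s := \sum_i w 0 i ^+ 2.
have s0 : 0 < s.
  rewrite lt_neqAle sumr_ge0 ?andbT => [|i _]; last exact: sqr_ge0.
  apply: contra w0; rewrite eq_sym psumr_eq0 => [/allP h|i _]; last exact: sqr_ge0.
  apply/eqP/matrixP => i j; rewrite !ord1 mxE.
  by have := h j; rewrite mem_index_enum sqrf_eq0 => /(_ isT)/eqP.
pose v := (Num.sqrt s)^-1 *: w^T.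
have v1 : v^T *m v = 1%:M.
  rewrite /v [(_ *: _)^T]linearZ /= trmxK -scalemxAl -scalemxAr scalerA -expr2 exprVn.
  rewrite sqr_sqrtr ?ltW//; apply/matrixP => i j; rewrite !ord1 !mxE eqxx.
  rewrite [X in _ * X](_ : _ = s) ?mulVf ?gt_eqF//.
  by apply: eq_bigr => k _; rewrite mxE expr2.
have Av : A *m v = a *: v by rewrite /v -scalemxAr Aw scalerA mulrC -scalerA.
have [H [HH HT Hv]] := householder v1.
pose B := H *m A *m H.
have BT : B^T = B by rewrite /B !trmx_mul HT symA mulmxA.
have Be : B *m delta_mx 0 0 = a *: (delta_mx 0 0 : 'cV_n.+1).
  by rewrite -Hv /B -!mulmxA (mulmxA H H) HH mul1mx Av -scalemxAr.
pose B' : 'M[R]_(1 + n) := B.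
(* The first column of [B'] is known from [Be]; symmetry gives the first row. *)
have BE : B' = block_mx a%:M 0 0 (drsubmx B').
  have B0 (i : 'I_(1 + n)) : B' i (lshift n 0) = a * (i == lshift n 0)%:R.
    by move/colP/(_ i): Be; rewrite -colE !mxE andbT /B' !lshift0.
  have B'T : B'^T = B' := BT.
  clearbody B'; rewrite -[LHS]submxK; congr block_mx.
  - by apply/matrixP => i j; rewrite !ord1 !mxE B0 eqxx mulr1.
  - apply/matrixP => i j; rewrite ord1 !mxE -B'T mxE B0.
    by rewrite eq_shift mulr0.
  - by apply/matrixP => i j; rewrite !ord1 !mxE B0 eq_shift mulr0.
have /IH[V [nu [VV dE]]] : (drsubmx B')^T = drsubmx B'.
  by rewrite trmx_drsub [B'^T]BT.
pose W : 'M[R]_(1 + n) := block_mx 1%:M 0 0 V.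
have WW : W *m W^T = 1%:M.
  rewrite /W tr_block_mx mulmx_block !trmx0 trmx1 !mulmx0 !mul0mx.
  by rewrite !addr0 add0r mulmx1 VV -scalar_mx_block.
pose mu : 'rV[R]_(1 + n) := row_mx a%:M nu.
have BW : B' = W *m diag_mx mu *m W^T.
  rewrite BE dE diag_mx_row /W tr_block_mx !mulmx_block !trmx0 trmx1.
  rewrite !mulmx0 !mul0mx !addr0 !add0r ?mulmx0 ?mul0mx mulmx1 !mul1mx ?mul0mx.
  congr block_mx; apply/matrixP => i j; by rewrite !ord1 !mxE eqxx !mulr1n.
exists (H *m (W : 'M[R]_n.+1)), mu; split.
  by rewrite trmx_mul mulmxA -(mulmxA H) WW mulmx1 HT.
rewrite trmx_mul HT !mulmxA -2!(mulmxA H) -[X in H *m X *m H]BW.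
by rewrite /B' /B !mulmxA HH mul1mx -mulmxA HH mulmx1.
Qed.

End RealSpectralTheorem.

(** * Functions of symmetric matrices *)

Section MatrixFunctions.
Context {R : realType}.
Implicit Types f g : R -> R.

(** The orthogonal matrix [W = V^T U] intertwines the two diagonals: [W i j] is zero unless
    [mu j = nu i]. Hence it also intertwines their images under [f]. *)
Lemma is_matfun_unique f n (M N N' : 'M[R]_n) :
  is_matfun f M N -> is_matfun f M N' -> N = N'.
Proof.
move=> [U [mu [UU -> ->]]] [V [nu [VV E ->]]].
have UtU := mulmx1C UU; have VtV := mulmx1C VV.
pose W := V^T *m U.
have WE : W *m diag_mx mu = diag_mx nu *m W.
  have := congr1 (fun X => V^T *m X *m U) E.
  by rewrite /W !mulmxA VtV mul1mx -(mulmxA _ U^T) UtU mulmx1.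
have UE : U = V *m W by rewrite /W mulmxA VV mul1mx.
have WW : W *m W^T = 1%:M.
  by rewrite /W trmx_mul trmxK mulmxA -(mulmxA _ U) UU mulmx1.
clearbody W.
suff WF : W *m diag_mx (map_mx f mu) = diag_mx (map_mx f nu) *m W.
  by rewrite UE -(mulmxA V) WF trmx_mul !mulmxA -(mulmxA _ W) WW mulmx1.
apply/matrixP => i j; rewrite mul_mx_diag mul_diag_mx !mxE.
have /matrixP/(_ i j) := WE; rewrite mul_mx_diag mul_diag_mx !mxE => Wij.
have [->|w0] := eqVneq (W i j) 0; first by rewrite mul0r mulr0.
by move: Wij; rewrite mulrC => /(mulIf w0) ->; rewrite mulrC.
Qed.

Lemma matfunE n (U : 'M[R]_n) (mu : 'rV[R]_n) f : U *m U^T = 1%:M ->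
  matfun f (U *m diag_mx mu *m U^T) = U *m diag_mx (map_mx f mu) *m U^T.
Proof.
move=> UU; apply: xget_unique; first by exists U, mu.
by move=> N /is_matfun_unique; apply; exists U, mu.
Qed.

Lemma matfun_scalar n f (c : R) : matfun f (c%:M : 'M[R]_n) = (f c)%:M.
Proof.
have := @matfunE n 1%:M (const_mx c) f; rewrite trmx1 !mulmx1 => /(_ erefl).
by rewrite !mul1mx diag_const_mx map_const_mx diag_const_mx.
Qed.

Lemma matfun_tr n f (M : 'M[R]_n) : M^T = M -> (matfun f M)^T = matfun f M.
Proof.
move=> /symmetric_spectral[U [mu [UU ->]]]; rewrite matfunE//.
by rewrite !trmx_mul trmxK tr_diag_mx mulmxA.
Qed.

(** The quadratic form at the [i]-th column of [U] equals [mu 0 i]. *)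
Lemma psdmx_diag n (U : 'M[R]_n) (mu : 'rV[R]_n) : U *m U^T = 1%:M ->
  psdmx (U *m diag_mx mu *m U^T) -> forall i, 0 <= mu 0 i.
Proof.
move=> UU [_ psd] i; have UtU := mulmx1C UU.
have := psd (U *m delta_mx i 0); rewrite trmx_mul !mulmxA.
rewrite -(mulmxA _ U^T) UtU mulmx1 -!mulmxA (mulmxA U^T U) UtU mul1mx.
rewrite trmx_delta -rowE -colE !mxE.
by rewrite eqxx.
Qed.

(** Allows a function to be modified on the negative reals, where neither monotonicity nor sign is
    assumed of it. *)
Lemma eq_matfun_psd n f g (M : 'M[R]_n) : psdmx M ->
  (forall x, 0 <= x -> f x = g x) -> matfun f M = matfun g M.
Proof.
move=> psdM fg; have [U [mu [UU ME]]] := symmetric_spectral psdM.1.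
rewrite ME in psdM *; rewrite !matfunE//.
congr (_ *m diag_mx _ *m _); apply/rowP => i; rewrite !mxE.
exact/fg/(psdmx_diag UU psdM).
Qed.

(** The symmetric idempotents [M X] and [M Y] agree, as do [X M] and [Y M]; then
    [X = X M X = Y M X = Y M Y = Y]. *)
Lemma mp_inverse_unique m n (M : 'M[R]_(m, n)) (X Y : 'M[R]_(n, m)) :
  is_mp_inverse M X -> is_mp_inverse M Y -> X = Y.
Proof.
move=> [mxm xmx mxT xmT] [mym ymy myT ymT].
have MXY : M *m X = M *m Y.
  by rewrite -mxT -[in LHS]mym -mulmxA trmx_mul mxT myT mulmxA mxm.
have XYM : X *m M = Y *m M.
  rewrite -xmT -[in LHS]mym !mulmxA -mulmxA trmx_mul ymT xmT.
  by rewrite -mulmxA (mulmxA M) mxm.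
by rewrite -xmx XYM -mulmxA MXY mulmxA ymy.
Qed.

(** The Penrose equations can be checked eigenvalue by eigenvalue, where they read
    [x * x^-1 * x = x] and [x^-1 * x * x^-1 = x^-1]; both hold at 0 since [0^-1 = 0]. *)
Lemma mp_inverse_symmetric n (M : 'M[R]_n) : M^T = M ->
  is_mp_inverse M (matfun GRing.inv M) /\ mp_inverse M = matfun GRing.inv M.
Proof.
move=> symM; suff H : is_mp_inverse M (matfun GRing.inv M).
  by split=> //; apply: xget_unique => // X; move/mp_inverse_unique; apply.
have := matfun_tr GRing.inv symM.
have [U [mu [UU ->]]] := symmetric_spectral symM.
rewrite matfunE// => _; have UtU := mulmx1C UU.
have mulD (a b : 'rV[R]_n) : U *m diag_mx a *m U^T *m (U *m diag_mx b *m U^T)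
    = U *m diag_mx (\row_i (a 0 i * b 0 i)) *m U^T.
  rewrite !mulmxA -(mulmxA _ U^T) UtU mulmx1 -(mulmxA U) mulmx_diag.
  by [].
have trD (a : 'rV[R]_n) : (U *m diag_mx a *m U^T)^T = U *m diag_mx a *m U^T.
  by rewrite !trmx_mul trmxK tr_diag_mx mulmxA.
split; rewrite ?mulD ?trD//; congr (_ *m diag_mx _ *m _);
  apply/rowP => i; rewrite !mxE.
- by have [->|m0] := eqVneq (mu 0 i) 0; rewrite ?mulr0// divff// mul1r.
- by have [->|m0] := eqVneq (mu 0 i) 0; rewrite ?invr0 ?mul0r// mulVf// mul1r.
Qed.

Lemma psdmx_congr m n (A : 'M[R]_n) (S : 'M[R]_(n, m)) :
  psdmx A -> psdmx (S^T *m A *m S).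
Proof.
move=> [AT A0]; split; first by rewrite !trmx_mul trmxK AT mulmxA.
by move=> x; have := A0 (S *m x); rewrite trmx_mul !mulmxA.
Qed.

(** Both [nystrom A S] and [A - nystrom A S] are exhibited as congruences of positive semidefinite
    matrices, of [M = S^T A S] and of [A] respectively. *)
Lemma nystrom_psd n l (A : 'M[R]_n) (S : 'M[R]_(n, l)) :
  psdmx A -> psdmx (nystrom A S) /\ loewner_le (nystrom A S) A.
Proof.
move=> psdA; have psdM := psdmx_congr S psdA; have AT := psdA.1.
rewrite /nystrom.
have [+ ->] := mp_inverse_symmetric psdM.1.
have := matfun_tr GRing.inv psdM.1; set X := matfun _ _ => XT [mxm xmx _ _].
set M := _ *m _ *m S in psdM mxm xmx.
have NE : A *m S *m X *m (A *m S)^T =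
    (X *m (A *m S)^T)^T *m M *m (X *m (A *m S)^T).
  rewrite [(X *m _)^T]trmx_mul trmxK XT.
  by rewrite -[in LHS]xmx !mulmxA.
split; first by rewrite NE; exact: psdmx_congr.
(* [1 - Z = S X S^T A] is idempotent because [X M X = X], and it is self-adjoint for the form
   defined by [A]. *)
rewrite /loewner_le; pose Z := 1%:M - S *m X *m (A *m S)^T.
suff -> : A - A *m S *m X *m (A *m S)^T = Z^T *m A *m Z by exact: psdmx_congr.
have ZT : Z^T = 1%:M - A *m S *m X *m S^T.
  by rewrite /Z linearB /= trmx1 trmx_mul trmxK trmx_mul XT !mulmxA.
rewrite ZT /Z mulmxBr mulmx1 !mulmxBl mul1mx trmx_mul AT.
set B := A *m S *m X *m S^T *m A.
have -> : A *m S *m X *m (S^T *m A) = B by rewrite /B !mulmxA.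
have -> : A *m (S *m X *m (S^T *m A)) = B by rewrite /B !mulmxA.
suff -> : B *m (S *m X *m (S^T *m A)) = B by rewrite subrr subr0.
have -> : B *m (S *m X *m (S^T *m A)) = A *m S *m (X *m M *m X) *m S^T *m A.
  by rewrite /B /M !mulmxA.
by rewrite xmx.
Qed.

(** Nonnegativity of the form at [e_a + e_b] and at [e_a - e_b] bounds [N a b] from below and from
    above. *)
Lemma psdmx_entry n (N : 'M[R]_n) a b : psdmx N ->
  `|N a b| <= (N a a + N b b) / 2.
Proof.
move=> [NT N0].
have E i j : (delta_mx i 0)^T *m N *m (delta_mx j 0 : 'cV_n) = (N i j)%:M.
  rewrite trmx_delta -rowE -colE; apply/matrixP => s t; rewrite !ord1 !mxE eqxx.
  by rewrite mulr1n.
have Nba : N b a = N a b by rewrite -{1}NT mxE.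
have := N0 (delta_mx a 0 + delta_mx b 0).
rewrite [(_ + _)^T]linearD /= mulmxDl !mulmxDr !mulmxDl !E !mxE eqxx !mulr1n Nba => h1.
have := N0 (delta_mx a 0 - delta_mx b 0).
rewrite [(_ - _)^T]linearB /= mulmxBl !mulmxBr !mulmxBl !E !mxE eqxx !mulr1n Nba => h2.
by rewrite ler_norml; apply/andP; split; lra.
Qed.

(** Operator monotonicity applied to 1 by 1 scalar matrices. Monotone functions are Borel, which is
    what measurability of [f(M)] rests on. *)
Lemma operator_monotone_class_nondecreasing f : operator_monotone_class f ->
  {in [pred x | 0 <= x] &, {homo f : x y / x <= y}}.
Proof.
move=> [_ _ mono] x y; rewrite !inE => x0 y0 xy.
have psd (c : R) : 0 <= c -> psdmx (c%:M : 'M[R]_1).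
  move=> c0; split; first by rewrite tr_scalar_mx.
  move=> z; rewrite mul_mx_scalar -scalemxAl mxE mulr_ge0// mxE.
  by rewrite big_ord1 mxE -expr2 sqr_ge0.
have /mono := psd x x0; move/(_ _ (psd y y0)).
rewrite /loewner_le -scalar_mx_is_additive => /(_ (psd _ _)).
rewrite subr_ge0 => /(_ xy); rewrite !matfun_scalar -scalar_mx_is_additive.
move=> [_ /(_ 1%:M)]; rewrite trmx1 mul1mx mulmx1 mxE eqxx mulr1n.
by rewrite subr_ge0.
Qed.

(** The bound does not depend on [S], so the entries of the random matrix are bounded random
    variables. The Loewner order compares only diagonal entries directly; [psdmx_entry] handles the
    others. *)
Lemma matfun_nystrom_entry f n l (A : 'M[R]_n) (S : 'M[R]_(n, l)) a b :
  psdmx A -> operator_monotone_class f ->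
  `|matfun f (nystrom A S) a b| <= (matfun f A a a + matfun f A b b) / 2.
Proof.
move=> psdA [f0 f00 mono]; have [psdN NA] := nystrom_psd S psdA.
have psd0 : psdmx (0 : 'M[R]_n).
  by split; [rewrite trmx0|move=> x; rewrite mulmx0 mul0mx mxE].
have psdfN : psdmx (matfun f (nystrom A S)).
  have := mono _ _ _ psd0 psdN; rewrite /loewner_le subr0 => /(_ psdN).
  (* The zero matrix is rewritten as a scalar matrix, whose image under [f] is the scalar
     [f 0 = 0]. *)
  by rewrite -(raddf0 (@scalar_mx R n)) matfun_scalar f00 raddf0 subr0.
have [_ le] := mono _ _ _ psdN psdA NA.
have diag i : matfun f (nystrom A S) i i <= matfun f A i i.
  have := le (delta_mx i 0); rewrite trmx_delta -rowE -colE !mxE.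
  by rewrite subr_ge0.
apply: le_trans (psdmx_entry _ _ psdfN) _.
by rewrite ler_pM2r// lerD.
Qed.

End MatrixFunctions.

(** * Measurability of matrix functions *)

(** Inversion is the pointwise limit of the continuous functions [x / (x^2 + 1/(m+1))], also at 0,
    where all of them vanish and [0^-1 = 0]. *)
Lemma measurable_invr (R : realType) : measurable_fun setT (fun x : R => x^-1).
Proof.
apply: (@measurable_fun_cvg _ R R setT (fun m x => x / (x ^+ 2 + m.+1%:R^-1))) => [m|x _].
  apply: continuous_measurable_fun => x.
  apply: cvgM; first exact: cvg_id.
  apply: cvgV; first by rewrite gt_eqF// ltr_wpDl ?sqr_ge0// invr_gt0.
  by apply: cvgD; [exact: sqr_continuous|exact: cvg_cst].
have [->|x0] := eqVneq x 0.
  by under eq_fun do rewrite mul0r; rewrite invr0; exact: cvg_cst.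
have -> : x^-1 = x / (x ^+ 2 + 0) by rewrite addr0; field.
apply: cvgM; first exact: cvg_cst.
apply: cvgV; first by rewrite addr0 sqrf_eq0.
by apply: cvgD; [exact: cvg_cst|exact: cvg_harmonic].
Qed.

Section MeasurableMatrixFunctions.
Context d (T : measurableType d) (R : realType).

Definition measurable_mx m n (N : T -> 'M[R]_(m, n)) :=
  forall a b, measurable_fun setT (fun w => N w a b).

Lemma measurable_mx_cst m n (N : 'M[R]_(m, n)) : measurable_mx (fun=> N).
Proof. by move=> a b; exact: measurable_cst. Qed.

Lemma measurable_mxD m n (N1 N2 : T -> 'M[R]_(m, n)) :
  measurable_mx N1 -> measurable_mx N2 -> measurable_mx (fun w => N1 w + N2 w).
Proof.
move=> m1 m2 a b; under eq_fun do rewrite mxE.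
exact: measurable_funD.
Qed.

Lemma measurable_mxM m n p (N1 : T -> 'M[R]_(m, n)) (N2 : T -> 'M[R]_(n, p)) :
  measurable_mx N1 -> measurable_mx N2 -> measurable_mx (fun w => N1 w *m N2 w).
Proof.
move=> m1 m2 a b; under eq_fun do rewrite mxE.
by apply: measurable_sum => i; exact: measurable_funM.
Qed.

Lemma measurable_mx_tr m n (N : T -> 'M[R]_(m, n)) :
  measurable_mx N -> measurable_mx (fun w => (N w)^T).
Proof. by move=> mN a b; under eq_fun do rewrite mxE; exact: mN. Qed.

Lemma measurable_det n (N : T -> 'M[R]_n) :
  measurable_mx N -> measurable_fun setT (fun w => \det (N w)).
Proof.
move=> mN; rewrite /determinant; apply: measurable_sum => s.
apply: measurable_funM => //.
by apply: measurable_prod => i _; exact: mN.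
Qed.

(** By the adjugate formula, the entries are quotients of determinants. *)
Lemma measurable_invmx n (N : T -> 'M[R]_n) : (forall w, N w \in unitmx) ->
  measurable_mx N -> measurable_mx (fun w => invmx (N w)).
Proof.
move=> uN mN a b; under eq_fun do rewrite /invmx uN !mxE.
apply: measurable_funM.
  by apply: measurableT_comp; [exact: measurable_invr|exact: measurable_det].
apply: measurable_funM => //; apply: measurable_det => i j.
by under eq_fun do rewrite !mxE; exact: mN.
Qed.

(** For a fixed diagonalization, each entry is a finite linear combination of the values of the
    function at the eigenvalues. *)
Lemma matfun_cvg n (M : 'M[R]_n) (F : nat -> R -> R) (f : R -> R) : M^T = M ->
  (forall x, F ^~ x @ \oo --> f x) ->
  forall a b, matfun (F m) M a b @[m --> \oo] --> matfun f M a b.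
Proof.
move=> /symmetric_spectral[U [mu [UU ->]]] Ff a b.
have E g : matfun g (U *m diag_mx mu *m U^T) a b =
    \sum_j U a j * g (mu 0 j) * U b j.
  rewrite matfunE// mxE; apply: eq_bigr => j _.
  by rewrite mul_mx_diag !mxE.
rewrite E; under eq_fun do rewrite E.
apply: cvg_big => [|j _]; first exact: add_continuous.
by apply: cvgMl; apply: cvgMr; exact: Ff.
Qed.

Lemma matfunD n (M : 'M[R]_n) f g : M^T = M ->
  matfun (f \+ g) M = matfun f M + matfun g M.
Proof.
move=> /symmetric_spectral[U [mu [UU ->]]]; rewrite !matfunE//.
rewrite -mulmxDl -mulmxDr -linearD; congr (_ *m diag_mx _ *m _).
by apply/rowP => i; rewrite !mxE.
Qed.

Lemma matfunM n (M : 'M[R]_n) f g : M^T = M ->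
  matfun (f \* g) M = matfun f M *m matfun g M.
Proof.
move=> /symmetric_spectral[U [mu [UU ->]]]; rewrite !matfunE//.
rewrite !mulmxA -(mulmxA _ U^T) (mulmx1C UU) mulmx1 -[_ *m diag_mx _ *m diag_mx _]mulmxA mulmx_diag.
by congr (_ *m diag_mx _ *m _); apply/rowP => i; rewrite !mxE.
Qed.

Lemma matfun_id n (M : 'M[R]_n) : M^T = M -> matfun id M = M.
Proof.
by move=> /symmetric_spectral[U [mu [UU ->]]]; rewrite matfunE// map_mx_id.
Qed.

Lemma matfun_cst n (M : 'M[R]_n) c : M^T = M -> matfun (cst c) M = c%:M.
Proof.
move=> /symmetric_spectral[U [mu [UU ->]]]; rewrite matfunE//.
rewrite (_ : map_mx _ _ = const_mx c); last by apply/rowP => i; rewrite !mxE.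
by rewrite diag_const_mx mul_mx_scalar -scalemxAl UU scalemx1.
Qed.

(** As [f] vanishes nowhere, the product of [f] and its inverse is the constant 1, whose matrix
    function is the identity. *)
Lemma matfunV n (M : 'M[R]_n) f : M^T = M -> (forall x, f x != 0) ->
  matfun f M \in unitmx /\ matfun (fun x => (f x)^-1) M = invmx (matfun f M).
Proof.
move=> symM f0.
have E : matfun f M *m matfun (fun x => (f x)^-1) M = 1%:M.
  rewrite -matfunM// -(matfun_cst 1 symM); congr (matfun _ M).
  by apply/funext => x /=; rewrite divff.
have [u _] := mulmx1_unit E; split=> //.
by rewrite -[LHS]mul1mx -(mulVmx u) -mulmxA E mulmx1.
Qed.

(** * The class of functions [g] for which [g(M)] is measurable, [M] a random symmetric matrix *)

Variables (n : nat) (M : T -> 'M[R]_n).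
Hypothesis symM : forall w, (M w)^T = M w.
Hypothesis mM : measurable_mx M.

Let ok (g : R -> R) := measurable_mx (fun w => matfun g (M w)).

Let ok_cst c : ok (cst c).
Proof.
rewrite /ok; under eq_fun do rewrite matfun_cst//; exact: measurable_mx_cst.
Qed.

Let okD f g : ok f -> ok g -> ok (f \+ g).
Proof.
move=> mf mg; rewrite /ok; under eq_fun do rewrite matfunD//.
exact: measurable_mxD.
Qed.

Let okM f g : ok f -> ok g -> ok (f \* g).
Proof.
move=> mf mg; rewrite /ok; under eq_fun do rewrite matfunM//.
exact: measurable_mxM.
Qed.

Let okV f : (forall x, f x != 0) -> ok f -> ok (fun x => (f x)^-1).
Proof.
move=> f0 mf; rewrite /ok; under eq_fun do rewrite (matfunV _ f0).2//.
by apply: measurable_invmx => // w; exact: (matfunV _ f0).1.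
Qed.

Let ok_id : ok id.
Proof. by rewrite /ok; under eq_fun do rewrite matfun_id//. Qed.

Let ok_sum I (r : seq I) (F : I -> R -> R) :
  (forall i, ok (F i)) -> ok (fun x => \sum_(i <- r) F i x).
Proof.
move=> okF; elim: r => [|i r IH].
  by under [X in ok X]eq_fun do rewrite big_nil; exact: ok_cst.
by under [X in ok X]eq_fun do rewrite big_cons; exact: okD.
Qed.

Let ok_prod I (r : seq I) (F : I -> R -> R) :
  (forall i, ok (F i)) -> ok (fun x => \prod_(i <- r) F i x).
Proof.
move=> okF; elim: r => [|i r IH].
  by under [X in ok X]eq_fun do rewrite big_nil; exact: ok_cst.
by under [X in ok X]eq_fun do rewrite big_cons; exact: okM.
Qed.

Let ok_cvg (F : nat -> R -> R) f : (forall m, ok (F m)) ->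
  (forall x, F ^~ x @ \oo --> f x) -> ok f.
Proof.
move=> okF Ff a b; apply: (measurable_fun_cvg (h := fun m w => matfun (F m) (M w) a b)).
  by move=> m; exact: okF.
by move=> w _; exact: matfun_cvg.
Qed.

(* [(1 + t ^+ (2 * m))^-1] tends to 1, 1/2 or 0 according as [`|t|] is less
   than, equal to or greater than 1; [h * (2 h - 1)] turns the value 1/2 into 0. *)
Let ok_itv (c r : R) : ok \1_[set x | ((x - c) / r) ^+ 2 < 1].
Proof.
pose q x := ((x - c) / r) ^+ 2.
have okq : ok q.
  have okt : ok ((id \+ cst (- c)) \* cst r^-1).
    exact: (okM (okD ok_id (ok_cst _)) (ok_cst _)).
  rewrite (_ : q = ((id \+ cst (- c)) \* cst r^-1) \* ((id \+ cst (- c)) \* cst r^-1)).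
    exact: (okM okt okt).
  by apply/funext => x; rewrite /q expr2.
have q0 x : 0 <= q x by exact: sqr_ge0.
pose h x : R := if q x < 1 then 1 else if q x == 1 then 2^-1 else 0.
have okh : ok h.
  apply: (@ok_cvg (fun m x => (1 + \prod_(i < m) q x)^-1)) => [m|x].
    apply: okV => [x|]; last exact: (okD (ok_cst 1) (ok_prod _ (fun=> okq))).
    by rewrite gt_eqF// ltr_pwDl// prodr_ge0.
  under eq_fun do rewrite prodr_const card_ord.
  rewrite /h; have [q1|q1|->] := ltgtP (q x) 1.
  - suff : (1 + q x ^+ m)^-1 @[m --> \oo] --> ((1 + 0)^-1 : R).
      by rewrite addr0 invr1.
    apply: cvgV; first by rewrite addr0.
    apply: cvgD; first exact: cvg_cst.
    by apply: cvg_expr; rewrite ger0_norm.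
  (* For [q x > 1] numerator and denominator are divided by [q x ^+ m], so that only powers of a
     number below 1 remain. *)
  - have qV : (q x)^-1 ^+ m / (1 + (q x)^-1 ^+ m) @[m --> \oo] --> (0 / (1 + 0) : R).
      have : `|(q x)^-1| < 1 by rewrite ger0_norm ?invr_ge0// invf_lt1// (lt_trans _ q1).
      move=> /cvg_expr qV; apply: cvgM => //; apply: cvgV; first by rewrite addr0.
      by apply: cvgD => //; exact: cvg_cst.
    rewrite mul0r in qV; apply: cvg_trans qV; apply: near_eq_cvg; near=> m.
    have qm : 0 < q x ^+ m by rewrite exprn_gt0// (lt_trans _ q1).
    rewrite exprVn; field; rewrite !gt_eqF// ?addr_gt0//.
  - by under eq_fun do rewrite expr1n; exact: cvg_cst.
rewrite (_ : \1__ = h \* (h \+ h \+ cst (-1))).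
  exact: (okM okh (okD (okD okh okh) (ok_cst (-1)))).
apply/funext => x /=; rewrite indicE /h -/(q x).
have [q1|q1|q1] := ltgtP (q x) 1.
- by rewrite mem_set//=; lra.
- by rewrite memNset/=; [lra|rewrite /q in q1; rewrite ltNge (ltW q1)].
- by rewrite memNset/=; [lra|rewrite -/(q x) q1 ltxx].
Unshelve. all: by end_near. Qed.

(** The indicator of the union is the limit of [1 - \prod_(i < m) (1 - \1_(A i))]; at each point
    this sequence is eventually constant. Differences are spelled with a factor -1 to stay within
    sums and products. *)
Let ok_bigcup (A : (set R)^nat) : (forall i, ok \1_(A i)) -> ok \1_(\bigcup_i A i).
Proof.
move=> okA.
apply: (@ok_cvg (fun m x => 1 + (-1) * \prod_(i < m) (1 + (-1) * \1_(A i) x))) => [m|x].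
  apply: (okD (ok_cst 1) (okM (ok_cst (-1)) (ok_prod _ _))) => i.
  exact: (okD (ok_cst 1) (okM (ok_cst (-1)) (okA i))).
apply: cvg_near_cst; rewrite indicE.
have [/set_mem[k _ Akx]|nA] := boolP (x \in _).
  near=> m; have km : (k < m)%N by near: m; exact: nbhs_infty_gt.
  by rewrite (bigD1 (Ordinal km))//= indicE mem_set// !mulN1r subrr mul0r subr0.
near=> m; rewrite big1 => [|i _]; first by rewrite mulN1r subrr.
rewrite indicE memNset; first by rewrite mulr0 addr0.
by move=> Aix; move: nA; rewrite notin_setE; apply; exists i.
Unshelve. all: by end_near. Qed.

Let ok_setC (A : set R) : ok \1_A -> ok \1_(~` A).
Proof.
move=> okA; rewrite (_ : \1__ = cst 1 \+ (cst (-1) \* \1_A)).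
  exact: (okD (ok_cst _) (okM (ok_cst _) okA)).
apply/funext => x /=; rewrite !indicE in_setC.
by case: (x \in A) => /=; ring.
Qed.

(** The sets with [ok] indicator form a sigma-algebra, and it contains the generating open rays: the
    ray above [c] is the union of the intervals with centre [c + i + 1] and radius [i + 1]. *)
Let ok_indic (A : set R) : measurable A -> ok \1_A.
Proof.
suff : @measurable _ R `<=` [set A | ok \1_A] by apply.
rewrite [X in X `<=` _]RGenOInfty.measurableE; apply: smallest_sub.
  split => /=.
  - by rewrite indic0; exact: ok_cst.
  - by move=> B; rewrite setTD; exact: ok_setC.
  - by move=> F; exact: ok_bigcup.
move=> _ [c ->] /=.
rewrite (_ : [set` _] = \bigcup_i
    [set x | ((x - (c + i.+1%:R)) / i.+1%:R) ^+ 2 < 1]).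
  by apply: ok_bigcup => i; exact: ok_itv.
have E (i : nat) (x : R) : (((x - (c + i.+1%:R)) / i.+1%:R) ^+ 2 < 1) =
    (c < x < c + 2 * i.+1%:R).
  rewrite -real_normK ?num_real// expr_lt1//.
  rewrite normrM normfV normr_nat ltr_pdivrMr ?ltr0n// mul1r.
  by rewrite ltr_norml; apply/andP/andP => -[? ?]; split; lra.
apply/seteqP; split => x /=; rewrite in_itv/= andbT; last first.
  by move=> [i _ /=]; rewrite E => /andP[].
(* This index works because [x - c] is less than its truncation plus 1. *)
move=> cx; exists (Num.truncn (x - c)) => //=; rewrite E cx /=.
have := truncnS_gt (x - c); rewrite -subr_gt0 => ?.
have : 0 < (Num.truncn (x - c)).+1%:R :> R by rewrite ltr0n.
lra.
Qed.

Import HBSimple HBNNSimple.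

(** A nonnegative measurable function is a pointwise limit of simple functions, which are finite
    combinations of indicators of measurable sets. *)
Lemma measurable_matfun (g : R -> R) : measurable_fun setT g ->
  (forall x, 0 <= g x) -> measurable_mx (fun w => matfun g (M w)).
Proof.
move=> mg g0.
have mEg : measurable_fun setT (EFin \o g) by exact/measurable_EFinP.
pose s := nnsfun_approx measurableT mEg.
apply: (@ok_cvg (fun m x => s m x) g) => [m|x]; last first.
  have := @cvg_nnsfun_approx _ _ _ _ measurableT _ mEg.
  move=> /(_ (fun x _ => g0 x) x Logic.I).
  exact: fine_cvg.
have -> : (fun x => s m x) = _ := funext (fimfunEord (s m)).
apply: ok_sum => i; apply: okM; first exact: ok_cst.
by apply: ok_indic; exact: measurable_sfunP.
Qed.

End MeasurableMatrixFunctions.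

(** * Moments of the standard normal distribution *)

Section NormalMoments.
Context {R : realType}.
Local Notation mu := (@lebesgue_measure R).
Local Notation phi := (@normal_pdf R 0 1).

(** The Radon-Nikodym derivative of the normal law has the same integral as the density over every
    measurable set, so the two agree almost everywhere. *)
Lemma integral_normal_prob m s (g : R -> \bar R) :
  measurable_fun setT g -> (forall x, 0 <= g x)%E ->
  (\int[normal_prob m s]_x g x = \int[mu]_x (g x * (normal_pdf m s x)%:E))%E.
Proof.
move=> mg g0.
have dom := @normal_prob_dominates R m s.
have mpdf : measurable_fun setT (EFin \o normal_pdf m s).
  by apply/measurable_EFinP; exact: measurable_normal_pdf.
rewrite -(Radon_Nikodym_SigmaFinite.change_of_variables dom)//.
apply: ae_eq_integral => //.
- apply: emeasurable_funM => //; apply: (measurable_int mu).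
  exact: Radon_Nikodym_SigmaFinite.f_integrable.
- exact: emeasurable_funM.
- apply: ae_eqe_mul2l => /=.
  apply: integral_ae_eq => //=.
  + exact: Radon_Nikodym_SigmaFinite.f_integrable.
  + by move=> E E01 mE; rewrite -Radon_Nikodym_SigmaFinite.f_integral.
Qed.

Let phiE x : phi x = normal_peak 1 * expR (- (x ^+ 2 / 2)).
Proof.
by rewrite normal_pdfE ?oner_eq0// /normal_fun subr0 expr1n mulNr.
Qed.

Let phiN x : phi (- x) = phi x.
Proof. by rewrite !phiE sqrrN. Qed.

Let c_phi : continuous phi.
Proof. by apply: continuous_normal_pdf; rewrite oner_eq0. Qed.

Let mphi : measurable_fun setT phi.
Proof. exact: measurable_normal_pdf. Qed.

Let phi0 x : 0 <= phi x. Proof. exact: normal_pdf_ge0. Qed.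

Let is_derive_phi (x : R) : is_derive x 1 phi (- x * phi x).
Proof.
rewrite (_ : phi = normal_peak 1 *: (expR \o (fun x => - (x ^+ 2 / 2)))); last first.
  by apply/funext => y; rewrite phiE.
by apply: is_derive_eq; rewrite !fctE /GRing.scale /=; field; rewrite ?pnatr_eq0.
Qed.

(* [-x^2/2 <= 1/2 - x] bounds the density on [0, oo) by [K * expR (- x)]; adding
   this integrable majorant makes [(x^2 - 1) phi], the derivative of [- x phi],
   nonnegative, as the improper fundamental theorem of calculus requires. *)
Let psi (x : R) : R := normal_peak 1 * expR 2^-1 * expR (- x).

Let phi_le_psi x : phi x <= psi x.
Proof.
rewrite phiE /psi -mulrA ler_wpM2l ?normal_peak_ge0// -expRD ler_expR.
by have := sqr_ge0 (x - 1); nra.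
Qed.

Let psi0 x : 0 <= psi x. Proof. exact: le_trans (phi_le_psi x). Qed.

Let is_derive_psi (x : R) : is_derive x 1 psi (- psi x).
Proof.
rewrite /psi; apply: is_derive_eq; rewrite /GRing.scale /=; ring.
Qed.

#[local] Existing Instance is_derive_phi.
#[local] Existing Instance is_derive_psi.

Let c_psi : continuous psi.
Proof.
move=> x; apply: differentiable_continuous; apply/derivable1_diffP.
by have [] := is_derive_psi x.
Qed.

Let mpsi : measurable_fun setT psi.
Proof. exact: continuous_measurable_fun. Qed.

Let cvg_psi : psi x @[x --> +oo] --> 0.
Proof.
rewrite -(mulr0 (normal_peak 1 * expR 2^-1)).
by apply: cvgMr; exact: cvgr_expR.
Qed.

(** Squeeze, using [x <= expR x] and [- x^2/2 <= 2 - 2 x], the latter from [(x - 2)^2 >= 0]; the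
    product of the exponentials is [expR (2 - x)]. *)
Let cvg_xphi : x * phi x @[x --> +oo] --> 0.
Proof.
apply: (@squeeze_cvgr _ _ _ _ (cst 0) (fun x => normal_peak 1 * expR 2 * expR (- x))).
- near=> x; have x0 : 0 < x by near: x; exact: nbhs_pinfty_gt.
  apply/andP; split; first by rewrite mulr_ge0// ltW.
  rewrite phiE mulrCA -mulrA ler_wpM2l ?normal_peak_ge0//.
  rewrite -expRD (_ : 2 - x = x + (2 - 2 * x)); last by ring.
  rewrite expRD; apply: ler_pM; [exact: ltW|exact: expR_ge0| |].
    by apply: le_trans (expR_ge1Dx x); rewrite lerDr.
  by rewrite ler_expR; have := sqr_ge0 (x - 2); nra.
- exact: cvg_cst.
- rewrite -(mulr0 (normal_peak 1 * expR 2)).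
  by apply: cvgMr; exact: cvgr_expR.
Unshelve. all: by end_near. Qed.

Let pos : set R := `[0, +oo[%classic.

Let integral_psi : (\int[mu]_(x in pos) (psi x)%:E = (psi 0)%:E)%E.
Proof.
rewrite (@ge0_continuous_FTC2y _ psi (fun x => - psi x) 0 0)//.
- by rewrite -EFinB sub0r opprK.
- exact: continuous_subspaceT.
- by rewrite -oppr0; exact: cvgN.
- by apply: cvg_at_right_filter; apply: cvgN; exact: c_psi.
- by move=> x _; rewrite derive1E (@derive_val _ _ _ _ _ _ _ (is_deriveN (is_derive_psi x))) opprK.
Qed.

(** Integration by parts: [f] is the derivative of [- x phi - psi], and [x phi] vanishes at 0 and at
    infinity, so [f] and [psi] have the same integral [psi 0]. *)
Let integral_pos_sqr_phi :
  (\int[mu]_(x in pos) (x ^+ 2 * phi x)%:E = \int[mu]_(x in pos) (phi x)%:E)%E.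
Proof.
pose f x := (x ^+ 2 - 1) * phi x + psi x.
have f0 x : 0 <= f x.
  by rewrite /f; have := phi0 x; have := phi_le_psi x; have := sqr_ge0 x; nra.
have mf : measurable_fun setT f.
  apply: measurable_funD => //; apply: measurable_funM => //.
  by apply: measurable_funB => //; exact: measurable_funX.
have mx2 : measurable_fun setT (fun x : R => x ^+ 2 * phi x).
  by apply: measurable_funM => //; exact: measurable_funX.
have int_f : (\int[mu]_(x in pos) (f x)%:E = (psi 0)%:E)%E.
  rewrite (@ge0_continuous_FTC2y _ f (fun x => - (x * phi x) - psi x) 0 0)//.
  - by rewrite -EFinB mul0r oppr0 !sub0r opprK.
  - apply: continuous_subspaceT => x; apply: cvgD; last exact: c_psi.
    apply: cvgM; last exact: c_phi.
    by apply: cvgB; [exact: sqr_continuous|exact: cvg_cst].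
  - suff : - (x * phi x) - psi x @[x --> +oo] --> (- 0 - 0 : R).
      by rewrite !oppr0 addr0.
    by apply: cvgB => //; apply: cvgN.
  - apply: cvg_at_right_filter; apply: cvgB; last exact: c_psi.
    by apply: cvgN; apply: cvgM; [exact: cvg_id|exact: c_phi].
  - move=> x _; rewrite derive1E derive_val /f /GRing.scale /=; ring.
(* Both integrands equal [x^2 phi + psi]. Only nonnegative terms are added, and the finite value
   [psi 0] is cancelled at the end. *)
have : (\int[mu]_(x in pos) (x ^+ 2 * phi x + psi x)%:E =
        \int[mu]_(x in pos) (f x + phi x)%:E)%E.
  by apply: eq_integral => x _; congr EFin; rewrite /f; ring.
have mEF (g : R -> R) : measurable_fun setT g -> measurable_fun pos (EFin \o g).
  by move=> mg; apply/measurable_EFinP; exact: measurable_funTS.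
under eq_integral do rewrite EFinD.
under [X in _ = X -> _]eq_integral do rewrite EFinD.
have mpos : measurable pos by exact: measurable_itv.
rewrite !ge0_integralD//=; try exact: mEF;
  try by move=> x _; rewrite lee_fin// mulr_ge0// sqr_ge0.
rewrite int_f integral_psi addeC => /(congr1 (fun z => (z - (psi 0)%:E)%E)).
by rewrite ![((psi 0)%:E + _)%E]addeC !addeK.
Qed.

(** Both [x^2 phi] and [phi] are even, so equality of their integrals over the half-line
    suffices. *)
Lemma integral_sqr_normal_pdf : (\int[mu]_x (x ^+ 2 * phi x)%:E = 1)%E.
Proof.
rewrite -(@integral_normal_pdf R 0 1).
have posE : [set x : R | 0 <= x] = pos by rewrite /pos set_itvcy.
rewrite (ge0_symfun_integralT (f := fun x => x ^+ 2 * phi x)).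
- rewrite [RHS]ge0_symfun_integralT//.
    by rewrite posE integral_pos_sqr_phi.
  by move=> x /=; rewrite phiN.
- by move=> x; rewrite mulr_ge0// sqr_ge0.
- by move=> x; apply: cvgM; [exact: sqr_continuous|exact: c_phi].
- by move=> x /=; rewrite sqrrN phiN.
Qed.

Lemma normal_second_moment : (\int[normal_prob (0 : R) 1]_x (x ^+ 2)%:E = 1)%E.
Proof.
rewrite integral_normal_prob.
- by under eq_integral do rewrite -EFinM; exact: integral_sqr_normal_pdf.
- by apply/measurable_EFinP; exact: measurable_funX.
- by move=> x; rewrite lee_fin sqr_ge0.
Qed.

Lemma integrable_sqr_normal :
  (normal_prob (0 : R) 1).-integrable setT (fun x => (x ^+ 2)%:E).
Proof.
apply/integrableP; split; first by apply/measurable_EFinP; exact: measurable_funX.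
under eq_integral do rewrite gee0_abs ?lee_fin ?sqr_ge0//.
by rewrite normal_second_moment ltry.
Qed.

(** Domination by the second moment: [|x| <= 1 + x^2]. *)
Lemma integrable_id_normal : (normal_prob (0 : R) 1).-integrable setT EFin.
Proof.
suff : (normal_prob (0 : R) 1).-integrable setT (fun x => 1 + (x ^+ 2)%:E)%E.
  apply: le_integrable => //.
  move=> x _; rewrite -EFinD !abse_EFin lee_fin.
  rewrite (@ger0_norm _ (1 + _)) ?addr_ge0 ?sqr_ge0//.
  by rewrite -real_normK ?num_real//; have := sqr_ge0 (`|x| - 1); have := normr_ge0 x; nra.
apply: integrableD => //; last exact: integrable_sqr_normal.
exact: finite_measure_integrable_cst.
Qed.

(** The positive and negative parts of [x] have equal finite integrals, by the substitution of [- x]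
    for [x] and evenness of [phi]. *)
Lemma normal_first_moment : (\int[normal_prob (0 : R) 1]_x x%:E = 0)%E.
Proof.
pose xpos (x : R) := Num.max x 0.
have mxpos : measurable_fun setT xpos.
  by apply: measurable_maxr => //; exact: measurable_cst.
have mxneg : measurable_fun setT (xpos \o -%R) by apply: measurableT_comp.
have xpos0 x : 0 <= xpos x by rewrite le_max lexx orbT.
have intpos : (normal_prob (0 : R) 1).-integrable setT (EFin \o xpos).
  apply: le_integrable integrable_id_normal => //.
    exact/measurable_EFinP.
  move=> x _ /=; rewrite lee_fin /xpos.
  by case: (leP x 0) => x0; rewrite ?normr0.
have intneg : (normal_prob (0 : R) 1).-integrable setT (EFin \o (xpos \o -%R)).
  apply: le_integrable integrable_id_normal => //.
    exact/measurable_EFinP.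
  move=> x _ /=; rewrite lee_fin /xpos.
  by case: (leP (- x) 0) => x0; rewrite ?normr0// normrN.
rewrite (_ : (fun x : R => x%:E) =
    (fun x => (EFin \o xpos) x - (EFin \o (xpos \o -%R)) x)%E); last first.
  apply/funext => x /=; rewrite -EFinB; congr EFin; rewrite /xpos.
  by case: (leP x 0) => x0; case: (leP (- x) 0) => y0; lra.
rewrite integralB//.
suff -> : (\int[normal_prob (0 : R) 1]_x (EFin \o xpos) x =
    \int[normal_prob (0 : R) 1]_x (EFin \o (xpos \o -%R)) x)%E.
  by rewrite subee//; exact: integrable_fin_num.
rewrite !integral_normal_prob//; try exact/measurable_EFinP;
  try by move=> x; rewrite /= lee_fin.
have E0 (g : R -> R) (A : set R) : (forall x, ~ A x -> g x = 0) ->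
    (\int[mu]_x ((g x)%:E * (phi x)%:E) = \int[mu]_(x in A) (g x * phi x)%:E)%E.
  move=> gA; rewrite [RHS]integral_mkcond; apply: eq_integral => x _.
  rewrite patchE; case: ifPn; rewrite ?EFinM// notin_setE => /gA ->.
  by rewrite mul0e.
rewrite (E0 _ pos); last first.
  move=> x; rewrite /pos /= in_itv/= andbT => /negP; rewrite -ltNge => x0.
  by rewrite /xpos max_r// ltW.
(* The endpoint is written [- 0] to fit the substitution rule, which maps this half-line to
   [pos]. *)
rewrite (E0 _ `]-oo, (- 0)%R]%classic); last first.
  move=> x; rewrite oppr0 /= in_itv/= => /negP; rewrite -ltNge => x0.
  by rewrite /xpos max_r// oppr_le0 ltW.
rewrite ge0_integration_by_substitutionNy.
- by apply: eq_integral => x _; rewrite /= opprK phiN.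
- apply: continuous_subspaceT => x; apply: cvgM; last exact: c_phi.
  apply: continuous_max; [|exact: cvg_cst].
  by apply: cvgN; exact: cvg_id.
- by move=> x _; apply: mulr_ge0 => /=.
Qed.

End NormalMoments.

(** * Independence *)

Section Independence.
Context d (T : measurableType d) (R : realType) (P : probability T R).

(** * Product rule for expectations of functions of two independent variables *)

Section IndependentPair.
Context d1 d2 (T1 : measurableType d1) (T2 : measurableType d2).
Variables (X : {mfun T >-> T1}) (Y : {mfun T >-> T2}).
Hypothesis XY : forall A B, measurable A -> measurable B ->
  P (X @^-1` A `&` Y @^-1` B) = (P (X @^-1` A) * P (Y @^-1` B))%E.
Variables (phi : T1 -> R) (psi : T2 -> R).
Hypotheses (mphi : measurable_fun setT phi) (mpsi : measurable_fun setT psi).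
Hypotheses (iphi : P.-integrable setT (EFin \o (phi \o X)))
  (ipsi : P.-integrable setT (EFin \o (psi \o Y))).

Let Z w := (X w, Y w).

Let mZ : measurable_fun setT Z.
Proof. exact: measurable_fun_pair. Qed.

HB.instance Definition _ := isMeasurableFun.Build _ _ _ _ Z mZ.

(** Independence says that the joint law and the product of the marginal laws agree on rectangles,
    which determines the product measure. *)
Let law S : measurable S ->
  (distribution P X \x distribution P Y)%E S = distribution P Z S.
Proof. by apply: product_measure_unique => A B mA mB; exact: XY. Qed.

Let F z := (phi z.1 * psi z.2)%:E.

Let mF : measurable_fun setT F.
Proof.
apply/measurable_EFinP; apply: measurable_funM.
  exact: measurableT_comp mphi measurable_fst.
exact: measurableT_comp mpsi measurable_snd.
Qed.

(** By Tonelli, the integral of the absolute value factors into the two finite absolute moments. *)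
Let integrable_F : (distribution P X \x distribution P Y)%E.-integrable setT F.
Proof.
apply/integrable12ltyP => //.
under eq_integral => x _.
  under eq_integral do rewrite /F EFinM abseM [_.2]/= [_.1]/=.
  rewrite ge0_integralZl//; last first.
    by apply: measurableT_comp => //; exact/measurable_EFinP.
  over.
rewrite ge0_integralZr//; last 2 first.
  by apply: measurableT_comp => //; exact/measurable_EFinP.
  exact: integral_ge0.
rewrite !ge0_integral_distribution//; last 2 first.
  by apply: measurableT_comp => //; exact/measurable_EFinP.
  by apply: measurableT_comp => //; exact/measurable_EFinP.
move: iphi ipsi => /integrableP[_ h1] /integrableP[_ h2].
by apply: lte_mul_pinfty => //; rewrite ?ge0_fin_numE//;
  apply: integral_ge0 => x _; exact: abse_ge0.
Qed.

Lemma independent_integrableM :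
  P.-integrable setT (fun w => (phi (X w) * psi (Y w))%:E).
Proof.
have /integrableP[_ iF] := integrable_F.
apply/integrableP; split; first exact: (measurableT_comp mF mZ).
have -> : (\int[P]_w `|(phi (X w) * psi (Y w))%:E| =
    \int[distribution P Z]_z `|F z|)%E.
  by rewrite ge0_integral_distribution//; exact: measurableT_comp.
rewrite (eq_measure_integral (distribution P X \x distribution P Y)%E)//.
by move=> S mS _; exact/esym/law.
Qed.

(** Transfer to the product of the laws, where Fubini applies; the inner integral is a finite
    constant times [phi x]. *)
Lemma independent_integralM :
  (\int[P]_w (phi (X w) * psi (Y w))%:E =
   \int[P]_w (phi (X w))%:E * \int[P]_w (psi (Y w))%:E)%E.
Proof.
have -> : (\int[P]_w (phi (X w) * psi (Y w))%:E = \int[distribution P Z]_z F z)%E.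
  by rewrite integral_distribution//; exact: independent_integrableM.
rewrite (eq_measure_integral (distribution P X \x distribution P Y)%E)//; last first.
  by move=> S mS _; exact/esym/law.
rewrite -integral12_prod_meas1// /fubini_F.
rewrite -(integral_distribution (X := Y) (f := EFin \o psi))//; last exact/measurable_EFinP.
rewrite -(integral_distribution (X := X) (f := EFin \o phi))//; last exact/measurable_EFinP.
have ipsi' : (distribution P Y).-integrable setT (EFin \o psi).
  by apply: integrable_pushforward => //; exact/measurable_EFinP.
have iphi' : (distribution P X).-integrable setT (EFin \o phi).
  by apply: integrable_pushforward => //; exact/measurable_EFinP.
under eq_integral => x _.
  under eq_integral do rewrite /F /= EFinM.
  rewrite integralZl//; over.
by rewrite /= -(fineK (integrable_fin_num measurableT ipsi')) -integralZr.
Qed.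

End IndependentPair.

(** [Y] collects the vectors other than [X i], with the dummy [p] in slot [i] to keep a [k]-tuple.
    For fixed [A], both sides are finite measures in [B] that agree on boxes, an intersection-stable
    family generating the product sigma-algebra. *)
Lemma mutually_independent_box d' (T' : measurableType d') k
    (X : 'I_k -> {RV P >-> T'}) (i : 'I_k) (p : T') :
  mutually_independent X ->
  forall (A : set T') (B : set (k.-tuple T')), measurable A -> measurable B ->
    let Y w := [tuple if j == i then p else X j w | j < k] in
    P (X i @^-1` A `&` Y @^-1` B) = (P (X i @^-1` A) * P (Y @^-1` B))%E.
Proof.
move=> indep A B mA mB Y.
have mXA : measurable (X i @^-1` A) by rewrite -[Q in measurable Q]setTI; exact: measurable_funP.
have mY : measurable_fun setT Y.
  apply/measurable_fun_tnthP => j; rewrite (_ : _ \o _ = fun w => if j == i then p else X j w).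
    by case: (j == i); [exact: measurable_cst|exact: measurable_funP].
  by apply/funext => w /=; rewrite tnth_mktuple.
pose box (C : 'I_k -> set T') := [set y : k.-tuple T' | forall j, C j (tnth y j)].
pose G : set (set (k.-tuple T')) :=
  [set box C | C in [set C | forall j, measurable (C j)]].
have mbox C : (forall j, measurable (C j)) -> measurable (box C).
  move=> mC; rewrite (_ : box C = \bigcap_(j in setT) ((fun y => tnth y j) @^-1` C j)).
    apply: fin_bigcap_measurable => // j _; rewrite -[Q in measurable Q]setTI.
    exact: measurable_tnth.
  by apply/seteqP; split => y h j; have := h j; exact.
have boxT : box (fun=> setT) = setT by apply/seteqP; split.
(* A cylinder over one coordinate is a box whose other sides are [setT]. *)
have GE : measurable = <<s G >>.
  apply/seteqP; split => S; last first.
    apply: smallest_sub; first exact: sigma_algebra_measurable.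
    by move=> _ [C mC <-]; exact: mbox.
  apply: smallest_sub; first exact: smallest_sigma_algebra.
  rewrite -bigcup_seq => {}S [j _ [D mD <-]]; apply: sub_sigma_algebra.
  exists (fun l => if l == j then D else setT).
    by move=> l /=; case: ifP.
  rewrite setTI; apply/seteqP; split => y /=.
    by move=> /(_ j); rewrite eqxx.
  by move=> Dy l; case: eqP => [->|].
have Yi w : tnth (Y w) i = p by rewrite tnth_mktuple eqxx.
have Yj w j : j != i -> tnth (Y w) j = X j w.
  by move=> ji; rewrite tnth_mktuple (negbTE ji).
have PT : P (X i @^-1` setT) = 1%E by rewrite preimage_setT probability_setT.
pose a : {nonneg R} := NngNum (fine_ge0 (measure_ge0 P (X i @^-1` A))).
pose Y' : {mfun T >-> k.-tuple T'} := mfun_Sub (mem_set mY).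
pose m1 := pushforward (mrestr P mXA) Y'.
pose m2 := mscale a (distribution P Y').
have aE : (a%:num)%:E = P (X i @^-1` A) by rewrite fineK// fin_num_measure.
have m1E S : m1 S = P (Y @^-1` S `&` X i @^-1` A) by [].
have m2E S : m2 S = (P (X i @^-1` A) * P (Y @^-1` S))%E by rewrite -aE.
suff : m1 B = m2 B by rewrite m1E m2E setIC.
apply: (measure_unique G (fun=> setT)) => //.
- move=> _ _ [C mC <-] [D mD <-]; exists (fun j => C j `&` D j).
    by move=> j; exact: measurableI.
  apply/seteqP; split => y /=; first by move=> CD; split => j; have [] := CD j.
  by move=> [yC yD] j; split.
- by move=> _; exists (fun=> setT); [move=> j; exact: measurableT|exact: boxT].
- exact: bigcup_const.
- move=> _ [C mC <-].
  rewrite [LHS]m1E [RHS]m2E.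
  (* Slot [i] of [Y] is constantly [p]: if [p] is outside [C i], the event is empty; otherwise side
     [i] imposes nothing and can be replaced by a condition on [X i]. *)
  have [Cp|Cp] := pselect (C i p); last first.
    have -> : Y @^-1` box C = set0.
      by apply/seteqP; split => w //= /(_ i); rewrite Yi.
    by rewrite set0I measure0 mule0.
  have boxE D : (Y @^-1` box C) `&` (X i @^-1` D) =
      [set w | forall j, (if j == i then D else C j) (X j w)].
    apply/seteqP; split => w /=.
      move=> [yC Dw] j; case: eqP => [->//|/eqP ji].
      by have := yC j; rewrite Yj.
    move=> h; split; last by have := h i; rewrite eqxx.
    move=> j; have [->|ji] := eqVneq j i; first by rewrite Yi.
    by have := h j; rewrite (negbTE ji) Yj.
  (* Used twice: [D = A] gives the joint probability, [D = setT] the probability that [Y] lies in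
     the box. *)
  have indepE D : measurable D -> P ((Y @^-1` box C) `&` (X i @^-1` D)) =
      (P (X i @^-1` D) * \prod_(j < k | j != i) P (X j @^-1` C j))%E.
    move=> mD; rewrite boxE.
    transitivity (\prod_(j < k) P (X j @^-1` (if j == i then D else C j)))%E.
      by apply: (indep (fun j => if j == i then D else C j)) => j; case: (j == i).
    rewrite (bigD1 i)//= eqxx; congr (_ * _)%E.
    by apply: eq_bigr => j /negbTE ->.
  rewrite indepE//; congr (_ * _)%E.
  by have := indepE setT measurableT; rewrite PT mul1e preimage_setT setIT => ->.
- move=> _; rewrite [ltLHS]m1E.
  by rewrite (le_lt_trans (probability_le1 P _))// ?ltry//; apply: measurableI => //;
    rewrite preimage_setT.
Qed.

End Independence.

(** * The estimator *)

Section Mean.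
Context d (T : measurableType d) (R : realType) (P : probability T R).

(** Integrability is bundled with the value because additivity of the integral requires it; both
    parts of the final claim then propagate together. *)
Definition has_mean (g : T -> R) (m : R) :=
  P.-integrable setT (EFin \o g) /\ (\int[P]_w (g w)%:E = m%:E)%E.

Lemma has_mean_cst c : has_mean (fun=> c) c.
Proof.
split; first exact: finite_measure_integrable_cst.
by rewrite integral_cst// [X in (_ * X)%E]probability_setT mule1.
Qed.

Lemma has_meanD g h m l : has_mean g m -> has_mean h l ->
  has_mean (fun w => g w + h w) (m + l).
Proof.
move=> [ig eg] [ih eh]; split.
  by rewrite (_ : _ \o _ = ((EFin \o g) \+ (EFin \o h))%E)//; exact: integrableD.
by under eq_integral do rewrite EFinD; rewrite integralD// eg eh.
Qed.

Lemma has_meanZ c g m : has_mean g m -> has_mean (fun w => c * g w) (c * m).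
Proof.
move=> [ig eg]; split.
  by rewrite (_ : _ \o _ = (fun w => c%:E * (EFin \o g) w)%E)//; exact: integrableZl.
by under eq_integral do rewrite EFinM; rewrite integralZl// eg.
Qed.

Lemma has_mean_sum I (r : seq I) (g : I -> T -> R) (m : I -> R) :
  (forall i, has_mean (g i) (m i)) ->
  has_mean (fun w => \sum_(i <- r) g i w) (\sum_(i <- r) m i).
Proof.
move=> gm; elim: r => [|i r IH].
  by under [X in has_mean X _]eq_fun do rewrite big_nil; rewrite big_nil; exact: has_mean_cst.
under [X in has_mean X _]eq_fun do rewrite big_cons.
by rewrite big_cons; exact: has_meanD.
Qed.

(** The mean stays unspecified: the estimator's two occurrences of it cancel. *)
Lemma bounded_has_mean (g : T -> R) C : measurable_fun setT g ->
  (forall w, `|g w| <= C) -> exists m, has_mean g m.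
Proof.
move=> mg gC.
have ig : P.-integrable setT (EFin \o g).
  apply: (le_integrable _ _ _ (finite_measure_integrable_cst P C measurableT)) => //.
    exact/measurable_EFinP.
  move=> w _ /=; rewrite lee_fin (le_trans (gC w))// ler_norm//.
exists (fine (\int[P]_w (g w)%:E)); split=> //.
by rewrite fineK//; exact: integrable_fin_num.
Qed.

Lemma independent_has_meanM d1 d2 (T1 : measurableType d1)
    (T2 : measurableType d2) (X : {mfun T >-> T1}) (Y : {mfun T >-> T2})
    (phi : T1 -> R) (psi : T2 -> R) m l :
  (forall A B, measurable A -> measurable B ->
    P (X @^-1` A `&` Y @^-1` B) = (P (X @^-1` A) * P (Y @^-1` B))%E) ->
  measurable_fun setT phi -> measurable_fun setT psi ->
  has_mean (phi \o X) m -> has_mean (psi \o Y) l ->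
  has_mean (fun w => phi (X w) * psi (Y w)) (m * l).
Proof.
move=> XY mphi mpsi [iphi ephi] [ipsi epsi]; split.
  exact: (independent_integrableM XY).
by rewrite (independent_integralM XY)// ephi epsi.
Qed.

(** * Coordinates of a standard normal vector and their second moments *)

Section StandardNormalVector.
Variables (n : nat) (X : {RV P >-> n.-tuple R}).
Hypothesis normX : standard_normal_vector X.

Let mcoord a : measurable_fun setT (fun w => tnth (X w) a).
Proof. exact: (measurableT_comp (measurable_tnth a)). Qed.

Let coord a : {mfun T >-> R} := mfun_Sub (mem_set (mcoord a)).

Let coord_law a (B : set R) : measurable B ->
  P (coord a @^-1` B) = normal_prob 0 1 B.
Proof.
move=> mB.
have mBT c : measurable (if c == a then B else setT) by case: (c == a).
have := normX (fun c => mBT c).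
rewrite (bigD1 a)//= eqxx big1 ?mule1 => [<-|c /negbTE ->]; last first.
  exact: probability_setT.
congr (P _); apply/seteqP; split => w /=; last by move/(_ a); rewrite eqxx.
by move=> Bw c; case: eqP => [->|].
Qed.

(** Evaluates the law on boxes with at most two sides different from [setT]. *)
Let coord_indep a b : a != b -> forall A B, measurable A -> measurable B ->
  P (coord a @^-1` A `&` coord b @^-1` B) =
  (P (coord a @^-1` A) * P (coord b @^-1` B))%E.
Proof.
move=> ab A B mA mB; rewrite !coord_law//.
have mAB c : measurable (if c == a then A else if c == b then B else setT).
  by case: (c == a) => //; case: (c == b).
have := normX (fun c => mAB c).
rewrite (bigD1 a)//= eqxx (bigD1 b)/= 1?eq_sym// (negbTE ab) eqxx.
rewrite big1 ?mule1 => [<-|c /andP[/negbTE -> /negbTE ->]]; last first.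
  exact: probability_setT.
congr (P _); apply/seteqP; split => w /=.
  by move=> [Aw Bw] c; case: eqP => [->//|_]; case: eqP => [->//|//].
move=> h; split; first by have := h a; rewrite eqxx.
by have := h b; rewrite eq_sym (negbTE ab) eqxx.
Qed.

Let coord_has_mean a (g : R -> R) m : measurable_fun setT g ->
  (normal_prob (0 : R) 1).-integrable setT (EFin \o g) ->
  (\int[normal_prob (0 : R) 1]_x (g x)%:E = m%:E)%E ->
  has_mean (g \o coord a) m.
Proof.
move=> mg ig eg.
(* The coordinate is retyped with codomain [measurableTypeR R], so that its distribution and
   [normal_prob] are measures on the same type. *)
have mcR : @measurable_fun _ _ T (measurableTypeR R) setT (coord a).
  by move=> mD B mB; exact: (mcoord a).
pose cR : {mfun T >-> measurableTypeR R} :=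
  @mfun_Sub _ _ T (measurableTypeR R) (coord a) (mem_set mcR).
have law (h : measurableTypeR R -> \bar R) :
    (\int[normal_prob (0 : R) 1]_x h x = \int[distribution P cR]_x h x)%E.
  apply: eq_measure_integral => B mB _; exact/esym/(coord_law a mB).
have mgR : @measurable_fun _ _ (measurableTypeR R) _ setT (EFin \o g).
  by have /measurable_EFinP mEg := mg; move=> mD B mB; exact: mEg.
have ic : P.-integrable setT (EFin \o (g \o coord a)).
  apply/integrableP; split.
    by apply/measurable_EFinP; exact: measurableT_comp.
  have /integrableP[_] := ig; rewrite law ge0_integral_distribution//.
  exact: (measurableT_comp _ mgR).
split=> //; rewrite -eg law integral_distribution//.
Qed.

(** The entrywise form of [E (x x^T) = I]; off the diagonal, independence gives a product of two
    zero means. *)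
Lemma standard_normal_vector_second_moments a b :
  has_mean (fun w => tnth (X w) a * tnth (X w) b) (a == b)%:R.
Proof.
have [<-|ab] := eqVneq a b.
  have := @coord_has_mean a (fun x => x ^+ 2) 1; apply.
  - exact: measurable_funX.
  - exact: integrable_sqr_normal.
  - exact: normal_second_moment.
have m0 c : has_mean (idfun \o coord c) 0.
  apply: (@coord_has_mean c idfun 0).
  - exact: measurable_id.
  - exact: integrable_id_normal.
  - exact: normal_first_moment.
have := independent_has_meanM (coord_indep ab) (@measurable_id _ _ _) (@measurable_id _ _ _) (m0 a) (m0 b).
by rewrite mulr0.
Qed.

End StandardNormalVector.
End Mean.

Section IFlexTrace.
Context {R : realType} (f : R -> R) (n : nat) (A : 'M[R]_n).
Hypotheses (psdA : psdmx A) (ff : operator_monotone_class f).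

(** [measurable_matfun] wants functions that are measurable and nonnegative on the whole line, so
    inversion and [f] are composed with [Num.max x 0]. This changes nothing on positive semidefinite
    matrices and makes [f] nondecreasing everywhere. *)
Lemma measurable_matfun_nystrom d (T : measurableType d) l
    (S : T -> 'M[R]_(n, l)) :
  measurable_mx S -> measurable_mx (fun w => matfun f (nystrom A (S w))).
Proof.
move=> mS.
have mpos : measurable_fun setT (fun x : R => Num.max x 0).
  by apply: measurable_maxr => //; exact: measurable_cst.
have mAS : measurable_mx (fun w => A *m S w).
  by apply: measurable_mxM => //; exact: measurable_mx_cst.
have psdSAS w := psdmx_congr (S w) psdA.
have mN : measurable_mx (fun w => nystrom A (S w)).
  have mSAS : measurable_mx (fun w => (S w)^T *m A *m S w).
    apply: measurable_mxM => //; apply: measurable_mxM; last exact: measurable_mx_cst.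
    exact: measurable_mx_tr.
  apply: measurable_mxM; last exact: measurable_mx_tr.
  apply: measurable_mxM => //.
  rewrite (_ : (fun w => _) = fun w => matfun (fun x => (Num.max x 0)^-1) ((S w)^T *m A *m S w)).
    apply: measurable_matfun => //; first by move=> w; case: (psdSAS w).
      exact: (measurableT_comp (@measurable_invr R)).
    by move=> x; rewrite invr_ge0 le_max lexx orbT.
  apply/funext => w; rewrite (mp_inverse_symmetric (psdSAS w).1).2.
  by apply: eq_matfun_psd => // x x0; rewrite max_l.
rewrite (_ : (fun w => _) = fun w => matfun (fun x => f (Num.max x 0)) (nystrom A (S w))).
  have [f0 _ _] := ff.
  apply: measurable_matfun => //.
  - by move=> w; case: (nystrom_psd (S w) psdA) => -[].
  - apply: nondecreasing_measurable => // x y xy.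
    apply: (operator_monotone_class_nondecreasing ff).
    + by rewrite inE le_max lexx orbT.
    + by rewrite inE le_max lexx orbT.
    + by rewrite ge_max !le_max xy lexx !orbT.
  - by move=> x; apply: f0; rewrite le_max lexx orbT.
apply/funext => w; apply: eq_matfun_psd => [|x x0]; last by rewrite max_l.
by have [] := nystrom_psd (S w) psdA.
Qed.

End IFlexTrace.

Lemma quadratic_formE (R : realType) n (M : 'M[R]_n) (x : 'cV[R]_n) :
  (x^T *m M *m x) 0 0 = \sum_a \sum_b x a 0 * x b 0 * M a b.
Proof.
rewrite mxE exchange_big; apply: eq_bigr => b _.
by rewrite mxE mulr_suml; apply: eq_bigr => a _; rewrite mxE mulrAC.
Qed.

Theorem theorem3p2 (R : realType) (d : measure_display) (T : measurableType d)
    (P : probability T R) (n k : nat) (A : 'M[R]_n) (f : R -> R)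
    (omega : 'I_k -> {RV P >-> n.-tuple R}) :
  psdmx A ->
  operator_monotone_class f ->
  (1 <= k <= n)%N ->
  (forall i, standard_normal_vector (omega i)) ->
  mutually_independent omega ->
  let tr_iFT := fun w : T => iflextrace f A (test_matrix omega w) in
  P.-integrable [set: T] (EFin \o tr_iFT) /\
  ('E_P[tr_iFT] = (\tr (matfun f A))%:E)%E.
Proof.
move=> psdA ff /andP[k1 _] normO indepO tr_iFT.
suff : has_mean P tr_iFT (\tr (matfun f A)).
  by move=> [itr etr]; split=> //; rewrite unlock.
set C := matfun f A.
(* The target is written as an average of [k] equal terms, so each summand can be treated
   separately. *)
have -> : \tr C = k%:R^-1 * \sum_(i < k) \tr C.
  by rewrite sumr_const card_ord -(mulr_natl (\tr C)) mulKf// pnatr_eq0 -lt0n.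
apply: has_meanZ; apply: has_mean_sum => i.
(* Any value would do for [p]: it fills column [i], which [col' i] deletes. *)
pose p : n.-tuple R := [tuple 0 | _ < n].
pose Y w : k.-tuple (n.-tuple R) := [tuple if j == i then p else omega j w | j < k].
have mY : measurable_fun setT Y.
  apply/measurable_fun_tnthP => j.
  rewrite (_ : _ \o _ = fun w => if j == i then p else omega j w).
    by case: (j == i); [exact: measurable_cst|exact: measurable_funP].
  by apply/funext => w /=; rewrite tnth_mktuple.
pose Y' : {mfun T >-> k.-tuple (n.-tuple R)} := mfun_Sub (mem_set mY).
pose S (y : k.-tuple (n.-tuple R)) : 'M[R]_(n, k.-1) :=
  col' i (\matrix_(a, j) tnth (tnth y j) a).
pose H y : 'M[R]_n := matfun f (nystrom A (S y)).
have mH : measurable_mx H.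
  apply: measurable_matfun_nystrom => // a j.
  rewrite /S; under eq_fun do rewrite !mxE.
  exact: (measurableT_comp (measurable_tnth _) (measurable_tnth _)).
have HE w : H (Y w) = matfun f (nystrom A (col' i (test_matrix omega w))).
  rewrite /H; congr (matfun f (nystrom A _)); apply/matrixP => a j.
  by rewrite !mxE tnth_mktuple eq_sym (negbTE (neq_lift _ _)).
have mHY a b : measurable_fun setT (fun w => H (Y w) a b).
  exact: (measurableT_comp (mH a b) mY).
have mean_H a b : exists h, has_mean P (fun w => H (Y w) a b) h.
  apply: (@bounded_has_mean _ _ _ _ _ ((C a a + C b b) / 2)) => // w.
  exact: matfun_nystrom_entry.
(* Choice gathers the unknown means into one matrix [h], the mean of [f(Ahat_{-i})]. *)
have {mean_H} [h mean_H] : exists h : 'I_n -> 'I_n -> R,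
    forall a b, has_mean P (fun w => H (Y w) a b) (h a b).
  exists (fun a b => projT1 (cid (mean_H a b))) => a b.
  exact: projT2 (cid (mean_H a b)).
(* The first two factors depend on [omega i] only and the last on [Y] only, so the mean factors. *)
have mean_prod a b : has_mean P
    (fun w => tnth (omega i w) a * tnth (omega i w) b * (C a b - H (Y w) a b))
    ((a == b)%:R * (C a b - h a b)).
  apply: (independent_has_meanM (X := omega i) (Y := Y')
    (phi := fun x => tnth x a * tnth x b) (psi := fun y => C a b - H y a b)).
  - by move=> B D mB mD; exact: (mutually_independent_box i p indepO mB mD).
  - by apply: measurable_funM; exact: measurable_tnth.
  - by apply: measurable_funB; [exact: measurable_cst|exact: mH].
  - exact: standard_normal_vector_second_moments.
  - have := has_meanD (has_mean_cst P (C a b)) (has_meanZ (-1) (mean_H a b)).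
    rewrite mulN1r; congr (has_mean P _ _).
    by apply/funext => w /=; rewrite mulN1r.
suff : has_mean P (fun w => \sum_a H (Y w) a a + \sum_a \sum_b
    tnth (omega i w) a * tnth (omega i w) b * (C a b - H (Y w) a b)) (\tr C).
  congr (has_mean P _ _); apply/funext => w /=.
  rewrite -HE quadratic_formE; congr (_ + _).
  by apply: eq_bigr => a _; apply: eq_bigr => b _; rewrite !mxE.
(* Only the terms with [a = b] survive, and there [h a a + (C a a - h a a) = C a a]. *)
have -> : \tr C = \sum_a h a a + \sum_a \sum_b (a == b)%:R * (C a b - h a b).
  rewrite -big_split; apply: eq_bigr => a _ /=.
  rewrite (bigD1 a)//= eqxx mul1r big1 => [|b ba]; first by rewrite addr0 addrC subrK.
  by rewrite eq_sym (negbTE ba) mul0r.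
apply: has_meanD; first by apply: has_mean_sum => a; exact: mean_H.
by apply: has_mean_sum => a; apply: has_mean_sum => b; exact: mean_prod.
Qed.
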